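(* For any natural number $d\in\{2n:n\in\mathbb{N},\,n\geq 4\}\cup\{4,5,6\}$ there are polynomials $f$ and $g$ in $\mathbb{R}[x_1,x_2]$ that satisfy the following statements: (i) The degree of $f$ is $d$ and the degree of $g$ is $\nu(d)$, where $$\nu(d)=\begin{cases} d-2, & \text{if } d\leq 6,\\ d-\frac{d-6}{2}-2, & \text{if } d>6.\end{cases}$$ (ii) There is a point $x'\in\mathbb{R}^2$ such that $g(x')>0$. (iii) The inclusion $S(g)\subseteq S(f)$ holds. (iv) There is no non-negative polynomial $t\in\mathbb{R}[x_1,x_2]$ such that $f(y)-t(y)g(y)\geq 0$ for all $y\in\mathbb{R}^2$.
   Context: For $h\in\mathbb{R}[x_1,x_2]$, $S(h)=\{x\in\mathbb{R}^2:h(x)\geq 0\}$. A polynomial $h$ is non-negative if $h(x)\geq 0$ for all $x\in\mathbb{R}^2$. Degree means total degree. *)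

(* Defs.v *)
From mathcomp Require Import all_boot all_order all_algebra.
From mathcomp Require Import classical_sets reals.
From mathcomp Require Import mpoly.

Set Implicit Arguments.
Unset Strict Implicit.
Unset Printing Implicit Defensive.

Import Order.TTheory GRing.Theory Num.Theory.

Local Open Scope classical_set_scope.
Local Open Scope ring_scope.

(* Points of the plane are functions 'I_2 -> R, the argument type of mpoly
   evaluation. *)
Definition nonneg_set (R : realType) (h : {mpoly R[2]}) : set ('I_2 -> R) :=
  [set x | 0 <= h.@[x]].

Definition nonneg_poly (R : realType) (h : {mpoly R[2]}) : Prop :=
  forall x : 'I_2 -> R, 0 <= h.@[x].

(* msize is 1 + the total degree for nonzero polynomials, and 0 for 0, so this
   entails h != 0. *)
Definition has_degree (R : realType) (h : {mpoly R[2]}) (k : nat) : Prop :=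
  msize h = k.+1.

(* No truncation occurs on the admissible degrees: they are at least 4, and
   those above 6 are even, so both the subtractions and the halving are exact. *)
Definition nu (d : nat) : nat :=
  if (d <= 6)%N then (d - 2)%N else (d - (d - 6) %/ 2 - 2)%N.

Definition admissible_degree (d : nat) : Prop :=
  (exists2 n : nat, (4 <= n)%N & d = (2 * n)%N) \/ d \in [:: 4; 5; 6]%N.

(* Main.v *)
Require Import Defs.
From mathcomp Require Import all_boot all_order all_algebra.
From mathcomp Require Import classical_sets reals.
From mathcomp Require Import mpoly.
From mathcomp Require Import polyrcf ring lra zify.

(** Two different obstructions to a multiplier t are at work.

    For d >= 5 the obstruction is local and one-dimensional.  The polynomial f
    is chosen to be non-negative on the upper half-plane and to satisfy
    f(0, y) = y, namely f = x^d + y for even d and f = (1 + x^4) y for d = 5.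
    With p odd, q > 0 even and {p, q} = {m, m - 1} for m = nu d >= 3, the
    polynomial g = y^p - x^q has degree m, and g >= 0 forces y^p >= x^q >= 0,
    hence y >= 0 and f >= 0.  On the line x = 0 a multiplier would satisfy
    y - t(0, y) y^p >= 0, that is t(0, y) y^(p-1) >= 1 for all y < 0; since
    p >= 2 the left-hand side tends to 0 with y
    ([no_multiplier_of_flat_zero]).  The parity of m only decides which of the
    two monomials of g carries the degree ([ex_multiplier_free_divisor]).

    For d = 4 the degree 2 of g leaves no room for y^p with p >= 3, and the
    obstruction comes from infinity ([quartic_example]).  Put
    A(x) = 4 (x - 1)^2 - x^2 and
      f = x^2 A(y) + y^2 A(x) + x^2 y^2,   g = A(x) + A(y).
    Away from the axes f = x^2 y^2 (4 (1 - 1/x)^2 + 4 (1 - 1/y)^2 - 1), so f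
    is a non-negative polynomial with double zeros at the origin, at the two
    points at infinity of the axes and at (1, 1), perturbed so as to become
    negative around (1, 1) only.  As f = 4 x^2 (y - 1)^2 + y^2 A(x), a point with
    f < 0 has A(x) < 0, and symmetrically A(y) < 0, so g < 0 there.  On the
    lines x = 0 and y = 1 both f and g restrict to polynomials of degree at
    most 2 and g grows like 3 s^2, so t is bounded, hence constant, on each of
    these lines ([quadratic_quotient_bound_const]).  Since f(0, 0) = 0 < g(0, 0),
    t vanishes at the origin, then at (0, 1), then at (1, 1), where f = -1: a
    contradiction. *)

Set Implicit Arguments.
Unset Strict Implicit.
Unset Printing Implicit Defensive.

Import Order.TTheory GRing.Theory Num.Theory.

Local Open Scope classical_set_scope.
Local Open Scope ring_scope.

(** * Univariate obstructions *)

Section UnivariateObstructions.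
Variable R : rcfType.
Implicit Types p q t : {poly R}.

Lemma lead_coef_ge0_of_nonneg p : (forall x, 0 <= p.[x]) -> 0 <= lead_coef p.
Proof.
move=> p_ge0; rewrite leNgt; apply/negP => lc_lt0.
have lcN : 0 < lead_coef (- p) by rewrite lead_coefN oppr_gt0.
have [N /(_ N (lexx N))] := poly_pinfty_gt_lc lcN.
rewrite leNgt => /negP; apply; rewrite hornerN.
by apply: le_lt_trans lcN; rewrite oppr_le0.
Qed.

(** If [t] had positive degree, [t * q] would dominate [p] and the leading
    coefficient of [p - t * q] would be negative. *)
Lemma nonneg_quotient_bound_size p q t :
    (size p <= size q)%N -> 0 < lead_coef q ->
    (forall x, 0 <= t.[x]) -> (forall x, 0 <= p.[x] - t.[x] * q.[x]) ->
  (size t <= 1)%N.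
Proof.
move=> le_pq lcq_gt0 t_ge0 ptq_ge0; rewrite leqNgt; apply/negP => t_gt1.
have t_neq0 : t != 0 by rewrite -size_poly_gt0; apply: leq_trans t_gt1.
have q_neq0 : q != 0 by rewrite -lead_coef_eq0 gt_eqF.
have lct_gt0 : 0 < lead_coef t.
  by rewrite lt_def lead_coef_eq0 t_neq0 lead_coef_ge0_of_nonneg.
have lt_ptq : (size p < size (- (t * q)))%N.
  rewrite size_polyN size_mul //; apply: leq_ltn_trans le_pq _.
  by rewrite ltn_predRL; move: t_gt1; rewrite -(ltn_add2r (size q)).
suff : 0 <= lead_coef (p - t * q).
  by rewrite lead_coefDr // lead_coefN lead_coefM oppr_ge0 leNgt mulr_gt0.
by apply: lead_coef_ge0_of_nonneg => x; rewrite hornerD hornerN hornerM.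
Qed.

Lemma quadratic_quotient_bound_const (p0 p1 p2 q0 q1 q2 : R) t :
    0 < q2 -> (forall x, 0 <= t.[x]) ->
    (forall x, 0 <= p0 + p1 * x + p2 * x ^+ 2
                    - t.[x] * (q0 + q1 * x + q2 * x ^+ 2)) ->
  forall x y, t.[x] = t.[y].
Proof.
move=> q2_gt0 t_ge0 ptq_ge0.
pose p := Poly [:: p0; p1; p2]; pose q := Poly [:: q0; q1; q2].
have qE : q = [:: q0; q1; q2] :> seq R.
  by rewrite (PolyK (c := 0)) //= gt_eqF.
have /size1_polyC -> : (size t <= 1)%N; last by move=> x y; rewrite !hornerC.
apply: (@nonneg_quotient_bound_size p q) => //.
- by rewrite qE size_Poly.
- by rewrite lead_coefE qE.
- move=> x; have := ptq_ge0 x; rewrite !horner_Poly /=.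
  by congr (0 <= _); ring.
Qed.

(** Dividing by [y < 0] turns the inequality into [1 - t.[y] * y ^+ k.-1 <= 0],
    which fails for [y] near 0 by continuity as soon as [k.-1 > 0]. *)
Lemma no_multiplier_of_flat_zero t k :
  (2 <= k)%N -> ~ (forall y, y < 0 -> 0 <= y - t.[y] * y ^+ k).
Proof.
case: k => [|[|k]] // _ H.
pose Q := 1 - t * 'X ^+ k.+1.
have Q0 : Q.[0] = 1 by rewrite /Q !hornerE expr0n /= mulr0 subr0.
have [d d_gt0 Hd] := poly_cont 0 Q ltr01.
have y_lt0 : - (d / 2) < 0 by rewrite oppr_lt0 divr_gt0.
have := Hd (- (d / 2)); rewrite subr0 normrN ger0_norm ?divr_ge0 ?ltW //.
rewrite ltr_pdivrMr // mulr_natr mulr2n ltrDl => /(_ d_gt0).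
rewrite Q0; set y := - (d / 2) in y_lt0 *.
have : Q.[y] <= 0.
  rewrite -(nmulr_rge0 _ y_lt0).
  have -> : y * Q.[y] = y - t.[y] * y ^+ k.+2.
    rewrite /Q hornerD hornerN hornerM horner_exp hornerX hornerC.
    by rewrite (exprS _ k.+1); ring.
  exact: H.
by move=> Qy; rewrite distrC ger0_norm; lra.
Qed.

End UnivariateObstructions.

(** * Polynomials in two variables given by lists of terms *)

Section PlanePolynomials.
Variable R : realType.
Implicit Types (s : seq (R * (nat * nat))) (v : 'I_2 -> R).

Definition bimon (e : nat * nat) : 'X_{1..2} :=
  (U_(ord0) *+ e.1 + U_(ord_max) *+ e.2)%MM.

Lemma mdeg_bimon e : mdeg (bimon e) = (e.1 + e.2)%N.
Proof. by rewrite mdegD !mdegMn !mdeg1 !mul1n. Qed.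

Lemma bimon_inj : injective bimon.
Proof.
move=> [a b] [a' b'] /mnmP E.
have := E ord0; have := E ord_max.
by rewrite /bimon !mnmDE !mulmnE !mnm1E /= !mul0n !mul1n !addn0 !add0n => -> ->.
Qed.

(** A list of terms, paired as coefficient and exponents, makes the degree and
    the values of an explicit polynomial computable by list operations. *)
Definition bipoly s : {mpoly R[2]} := \sum_(a <- s) a.1 *: 'X_[bimon a.2].

Lemma meval_bipoly s v :
  (bipoly s).@[v] =
    \sum_(a <- s) a.1 * (v ord0 ^+ a.2.1 * v ord_max ^+ a.2.2).
Proof.
rewrite /bipoly raddf_sum /=; apply: eq_bigr => a _.
by rewrite mevalZ mpolyXD mevalM -!mpolyXn !rmorphXn /= !mevalXU.
Qed.

(** The terms may repeat exponents, so the coefficient of [e] is the sum over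
    all of its occurrences. *)
Lemma has_degree_bipoly s e k :
    all (fun a => a.2.1 + a.2.2 <= k)%N s -> (e.1 + e.2 = k)%N ->
    \sum_(a <- s | a.2 == e) a.1 != 0 ->
  has_degree (bipoly s) k.
Proof.
move=> /allP le_k deg_e coef_neq0; rewrite /has_degree; apply/eqP.
rewrite eqn_leq; apply/andP; split.
  rewrite msizeE; apply/bigmax_leqP_seq => m m_supp _.
  have /flattenP[_ /mapP[a a_s ->]] := msupp_sum_le m_supp.
  rewrite mem_filter /= in a_s.
  move=> /msuppZ_le; rewrite msuppX inE => /eqP ->.
  by rewrite ltnS mdeg_bimon le_k.
rewrite -deg_e -mdeg_bimon msize_mdeg_lt // mcoeff_msupp /bipoly raddf_sum /=.
rewrite [X in X != 0](_ : _ = \sum_(a <- s | a.2 == e) a.1) //.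
rewrite [RHS]big_mkcond; apply: eq_bigr => a _ /=.
rewrite mcoeffZ mcoeffX (inj_eq bimon_inj).
by case: eqP; rewrite ?mulr1 ?mulr0.
Qed.

Definition restrict (l : 'I_2 -> {poly R}) (t : {mpoly R[2]}) : {poly R} :=
  mmap (@polyC R) l t.

Lemma horner_restrict l t x : (restrict l t).[x] = t.@[fun i => (l i).[x]].
Proof.
rewrite /restrict /meval /mmap horner_sum; apply: eq_bigr => m _.
rewrite hornerM hornerC horner_prod; congr (_ * _).
by apply: eq_bigr => i _; rewrite horner_exp.
Qed.

Definition pt (S : Type) (a b : S) : 'I_2 -> S :=
  fun i => if i == ord0 then a else b.

Lemma horner_restrict_pt a b t x :
  (restrict (pt a b) t).[x] = t.@[pt a.[x] b.[x]].
Proof.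
by rewrite horner_restrict; apply: meval_eq => i; rewrite /pt; case: ifP.
Qed.

Lemma bipoly_pt (s : seq (R * (nat * nat))) (a b : R) :
  (bipoly s).@[pt a b] = \sum_(c <- s) c.1 * (a ^+ c.2.1 * b ^+ c.2.2).
Proof. by rewrite meval_bipoly. Qed.

End PlanePolynomials.

(** * Degrees at least five, obstructed at the origin *)

(** The condition [f.@[pt 0 y] = y] makes [f] change sign to first order at the
    origin, where [g] vanishes to order at least 3 along the same line. *)
Lemma ex_multiplier_free_divisor (R : realType) (f : {mpoly R[2]}) m :
    (3 <= m)%N -> (forall y, f.@[pt 0 y] = y) ->
    (forall v, 0 <= v ord_max -> 0 <= f.@[v]) ->
  exists g : {mpoly R[2]},
    [/\ has_degree g m, exists x' : 'I_2 -> R, 0 < g.@[x'],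
        nonneg_set g `<=` nonneg_set f
      & ~ exists t : {mpoly R[2]},
            nonneg_poly t /\
            forall y : 'I_2 -> R, 0 <= f.@[y] - t.@[y] * g.@[y]].
Proof.
move=> m_ge3 f0y f_ge0.
(* An odd exponent of y and an even one of x, the larger of the two being m. *)
pose p := if odd m then m else m.-1; pose q := if odd m then m.-1 else m.
have [p_odd q_even] : odd p /\ ~~ odd q.
  by rewrite /p /q; case: ifP => ?; split; lia.
have [p_ge3 q_gt0] : (3 <= p)%N /\ (0 < q)%N.
  by rewrite /p /q; case: ifP => ?; split; lia.
have [p_le q_le] : (p <= m)%N /\ (q <= m)%N.
  by rewrite /p /q; case: ifP => ?; split; lia.
exists (bipoly [:: (1, (0, p)%N); (-1, (q, 0)%N)]); split.
- have [m_odd|m_even] := boolP (odd m).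
    apply: (@has_degree_bipoly _ _ (0, p)%N) => /=.
      by rewrite add0n addn0 p_le q_le.
      by rewrite /p m_odd.
    rewrite !big_cons big_nil /= !xpair_eqE !eqxx /= (gtn_eqF q_gt0) /= addr0.
    exact: oner_neq0.
  apply: (@has_degree_bipoly _ _ (q, 0)%N) => /=.
    by rewrite add0n addn0 p_le q_le.
    by rewrite addn0 /q (negbTE m_even).
  rewrite !big_cons big_nil /= !xpair_eqE !eqxx /= (ltn_eqF q_gt0) /= addr0.
  by rewrite oppr_eq0 oner_neq0.
- exists (pt 0 1); rewrite bipoly_pt !big_cons big_nil /=.
  by rewrite (expr0n _ q) (gtn_eqF q_gt0) !expr1n !expr0 /=; lra.
- move=> v; rewrite /nonneg_set /= meval_bipoly !big_cons big_nil /= => g_ge0.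
  apply: f_ge0; rewrite -(exprn_odd_ge0 _ p_odd).
  have := exprn_even_ge0 (v ord0) q_even.
  by move: g_ge0; rewrite !expr0; lra.
- case=> t [_ ftg_ge0].
  apply: (@no_multiplier_of_flat_zero R (restrict (pt 0%:P 'X) t) p).
    exact: ltnW.
  move=> y _; have := ftg_ge0 (pt 0 y).
  rewrite horner_restrict_pt hornerC hornerX f0y bipoly_pt !big_cons big_nil /=.
  by rewrite (expr0n _ q) (gtn_eqF q_gt0) !expr0 mul1r !mul0r mulr0 !addr0 mul1r.
Qed.

(** * The quartic example, obstructed at infinity *)

(** The only negative values of [f] are around [(1, 1)], and the slow growth of
    [f] on the lines [x = 0] and [y = 1], one through the origin and the other
    through [(1, 1)], forces [t] to vanish on both. *)
Lemma quartic_example (R : realType) : exists f g : {mpoly R[2]},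
    [/\ has_degree f 4 /\ has_degree g 2,
        exists x' : 'I_2 -> R, 0 < g.@[x'],
        nonneg_set g `<=` nonneg_set f
      & ~ exists t : {mpoly R[2]},
            nonneg_poly t /\
            forall y : 'I_2 -> R, 0 <= f.@[y] - t.@[y] * g.@[y]].
Proof.
pose f : {mpoly R[2]} := bipoly
  [:: (7, (2, 2)%N); (- 8, (2, 1)%N); (4, (2, 0)%N);
      (- 8, (1, 2)%N); (4, (0, 2)%N)].
pose g : {mpoly R[2]} := bipoly
  [:: (3, (2, 0)%N); (3, (0, 2)%N); (- 8, (1, 0)%N); (- 8, (0, 1)%N);
      (8, (0, 0)%N)].
pose A (x : R) := 4 * (x - 1) ^+ 2 - x ^+ 2.
have fE v : f.@[v] = v ord0 ^+ 2 * A (v ord_max) + v ord_max ^+ 2 * A (v ord0)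
                     + v ord0 ^+ 2 * v ord_max ^+ 2.
  by rewrite meval_bipoly !big_cons big_nil /A /=; ring.
have gE v : g.@[v] = A (v ord0) + A (v ord_max).
  by rewrite meval_bipoly !big_cons big_nil /A /=; ring.
exists f, g; split.
- split.
    apply: (@has_degree_bipoly _ _ (2, 2)%N) => //=.
    by rewrite !big_cons big_nil /= addr0 pnatr_eq0.
  apply: (@has_degree_bipoly _ _ (2, 0)%N) => //=.
  by rewrite !big_cons big_nil /= addr0 pnatr_eq0.
- by exists (pt 0 0); rewrite gE /A /pt /=; lra.
- move=> v; rewrite /nonneg_set /= gE fE.
  set x := v ord0; set y := v ord_max => g_ge0.
  wlog Ax_ge0 : x y g_ge0 / 0 <= A x.
    move=> H; have [/H|Ax_lt0] := leP 0 (A x); first exact.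
    have : 0 <= A y by lra.
    by rewrite addrC in g_ge0 => /(H y x g_ge0); congr (0 <= _); ring.
  (* The term x^2 y^2 cancels the negative part of x^2 A(y). *)
  have -> : x ^+ 2 * A y + y ^+ 2 * A x + x ^+ 2 * y ^+ 2 =
            x ^+ 2 * (4 * (y - 1) ^+ 2) + y ^+ 2 * A x by rewrite /A; ring.
  by rewrite addr_ge0 // mulr_ge0 ?sqr_ge0 // mulr_ge0 ?sqr_ge0 //.
- case=> t [t_ge0 ftg_ge0].
  have t01 : t.@[pt 0 1] = 0.
    pose t0 := restrict (pt 0%:P 'X) t.
    have t0E y : t0.[y] = t.@[pt 0 y].
      by rewrite /t0 horner_restrict_pt hornerC hornerX.
    have t00 : t0.[0] = 0.
      apply: le_anti; rewrite t0E t_ge0 andbT.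
      by have := ftg_ge0 (pt 0 0); rewrite fE gE /A /pt /=; lra.
    rewrite -t0E -[RHS]t00.
    apply: (@quadratic_quotient_bound_const R 0 0 4 8 (- 8) 3) => [|y|y].
    + by [].
    + by rewrite t0E.
    have := ftg_ge0 (pt 0 y); rewrite t0E fE gE.
    by congr (0 <= _); rewrite /A /pt /=; ring.
  have t11 : t.@[pt 1 1] = 0.
    pose t1 := restrict (pt 'X 1%:P) t.
    have t1E x : t1.[x] = t.@[pt x 1].
      by rewrite /t1 horner_restrict_pt hornerC hornerX.
    rewrite -[RHS]t01 -!t1E.
    apply: (@quadratic_quotient_bound_const R 4 (- 8) 3 3 (- 8) 3) => [|x|x].
    + by [].
    + by rewrite t1E.
    have := ftg_ge0 (pt x 1); rewrite t1E fE gE.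
    by congr (0 <= _); rewrite /A /pt /=; ring.
  by have := ftg_ge0 (pt 1 1); rewrite t11 fE /A /pt /=; lra.
Qed.

(** * All admissible degrees *)

Theorem proposition3p6p5 (R : realType) (d : nat) (hd : admissible_degree d) :
  exists f g : {mpoly R[2]},
    [/\ has_degree f d /\ has_degree g (nu d),
        exists x' : 'I_2 -> R, 0 < g.@[x'],
        nonneg_set g `<=` nonneg_set f
      & ~ exists t : {mpoly R[2]},
            nonneg_poly t /\
            forall y : 'I_2 -> R, 0 <= f.@[y] - t.@[y] * g.@[y]].
Proof.
have [-> | d_neq4] := eqVneq d 4%N; first exact: quartic_example.
suff [nu_ge3 [f [f_deg f0y f_ge0]]] : (3 <= nu d)%N /\ exists f : {mpoly R[2]},
    [/\ has_degree f d, forall y, f.@[pt 0 y] = y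
      & forall v, 0 <= v ord_max -> 0 <= f.@[v]].
  have [g [g_deg g_pos sub no_t]] :=
    ex_multiplier_free_divisor nu_ge3 f0y f_ge0.
  by exists f, g; split.
have [-> | d_neq5] := eqVneq d 5%N.
  split=> //; exists (bipoly [:: (1, (0, 1)%N); (1, (4, 1)%N)]); split.
  - apply: (@has_degree_bipoly _ _ (4, 1)%N) => //=.
    by rewrite !big_cons big_nil /= addr0 oner_neq0.
  - by move=> y; rewrite bipoly_pt !big_cons big_nil /=; ring.
  - move=> v v_ge0; rewrite meval_bipoly !big_cons big_nil /=.
    rewrite [X in 0 <= X](_ : _ = (1 + v ord0 ^+ 4) * v ord_max); last by ring.
    by rewrite mulr_ge0 // addr_ge0 // exprn_even_ge0.
have [d_even d_ge6] : ~~ odd d /\ (6 <= d)%N.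
  case: hd => [[n n_ge4 ->]|]; first by split; lia.
  by rewrite !inE (negbTE d_neq4) (negbTE d_neq5) => /eqP ->.
split; first by rewrite /nu; case: ifP; lia.
have d_neq0 : (d == 0)%N = false by lia.
exists (bipoly [:: (1, (d, 0)%N); (1, (0, 1)%N)]); split.
- apply: (@has_degree_bipoly _ _ (d, 0)%N); rewrite /= ?addn0 ?leqnn //=.
    by rewrite andbT; lia.
  by rewrite !big_cons big_nil /= !xpair_eqE !eqxx /= andbF addr0 oner_neq0.
- move=> y; rewrite bipoly_pt !big_cons big_nil /=.
  by rewrite expr0n d_neq0 /=; ring.
- move=> v v_ge0; rewrite meval_bipoly !big_cons big_nil /=.
  rewrite [X in 0 <= X](_ : _ = v ord0 ^+ d + v ord_max); last by ring.
  by rewrite addr_ge0 // exprn_even_ge0.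
Qed.
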